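(* Let $X$ be a $T_1$ space with at least two points, let $\mathcal{B}$ be a normal base for the closed sets of $X$, and let $\delta_b$ be the Wallman-Frink proximity associated with $\mathcal{B}$. Let $\alpha_{\delta_b}X$ be the Gagrat-Naimpally completion of $(X,\delta_b)$, i.e. the space of all maximal clans on $(X,\delta_b)$. Then $T_bX=\{\Pi(\alpha) : \alpha \text{ is an ultrafilter of type } b\}$ is a subset of $\alpha_{\delta_b}X$ and, with the subspace topology, $T_bX$ is a $T_1$ compactification of $X$; that is, $T_bX$ is a compact $T_1$ space and the map $x\mapsto \Pi(\mu_x)$, where $\mu_x=\{A\subseteq X : x\in A\}$, is a homeomorphism of $X$ onto a dense subspace of $T_bX$.
   Context: A family $\mathcal{B}$ of closed subsets of $X$ is a base for the closed sets if every closed set is the intersection of a nonempty subfamily of $\mathcal{B}$ (so $X\in\mathcal{B}$). A *normal base* is a base $\mathcal{B}$ for the closed sets such that (1) $\mathcal{B}$ is a network: if $x\in G$ with $G$ open, there is $B\in\mathcal{B}$ with $x\in B\subseteq G$; and (2) $\mathcal{B}$ is a ring of sets: closed under finite unions and finite intersections. The *Wallman-Frink proximity* $\delta_b$ is the relation on subsets of $X$ such that $A\,\delta_b\,B$ fails iff there are $F_1,F_2\in\mathcal{B}$ with $A\subseteq F_1$, $B\subseteq F_2$, $F_1\cap F_2=\emptyset$. For families $\gamma,\gamma'$ of subsets of $X$, $\gamma\,\delta_b\,\gamma'$ means $A\,\delta_b\,B$ for all $A\in\gamma$, $B\in\gamma'$. A *filterbase* is a nonempty family of nonempty sets such that the intersection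 of any two members contains a member. A *$b$-filter* is a filterbase $\mathcal{F}\subseteq\mathcal{B}$ such that $B\in\mathcal{F}$ and $B\subseteq F\in\mathcal{B}$ imply $F\in\mathcal{F}$; a *$b$-ultrafilter* is a maximal $b$-filter. An ultrafilter $\mu$ on $X$ is *of type $b$* if $\mu\cap\mathcal{B}$ is a $b$-ultrafilter. For an ultrafilter $\alpha$, $\Pi(\alpha)=\bigcup\{\upsilon : \upsilon \text{ is an ultrafilter on } X \text{ and } \upsilon\,\delta_b\,\alpha\}$. A *grill* on $X$ is a nonempty family of nonempty subsets of $X$ that is closed under supersets and such that whenever $A\cup B$ belongs to it, $A$ or $B$ does (equivalently, a union of a nonempty set of ultrafilters). A *clan* on $(X,\delta_b)$ is a grill $\gamma$ with $A\,\delta_b\,B$ for all $A,B\in\gamma$; a maximal clan is one maximal under inclusion. The topology on the set $\alpha_{\delta_b}X$ of all maximal clans is the one having the sets $A^*=\{\sigma : A\in\sigma\}$, $A\subseteq X$, as a base for its closed sets (absorption topology). *)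

(* Defs.v *)
From HB Require Import structures.
From mathcomp Require Import all_boot all_classical topology.

Set Implicit Arguments.
Unset Strict Implicit.
Unset Printing Implicit Defensive.

Local Open Scope classical_set_scope.

Definition closed_base {X : topologicalType} (B : set (set X)) : Prop :=
  (forall F, B F -> closed F) /\
  (forall C : set X, closed C -> exists S : set (set X),
     [/\ S `<=` B, S !=set0 & C = \bigcap_(F in S) F]).

Definition network {X : topologicalType} (B : set (set X)) : Prop :=
  forall (x : X) (G : set X), open G -> G x ->
    exists F, [/\ B F, F x & F `<=` G].

Definition normal_base {X : topologicalType} (B : set (set X)) : Prop :=
  [/\ closed_base B, network B, setU_closed B & setI_closed B].

Definition wallman_frink {X : Type} (B : set (set X)) (A C : set X) : Prop :=
  ~ exists F1 F2 : set X,
      [/\ B F1, B F2, A `<=` F1, C `<=` F2 & F1 `&` F2 = set0].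

Definition near_families {X : Type} (delta : set X -> set X -> Prop)
    (gamma gamma' : set (set X)) : Prop :=
  forall A C, gamma A -> gamma' C -> delta A C.

Definition filterbase {X : Type} (F : set (set X)) : Prop :=
  [/\ F !=set0, (forall A, F A -> A !=set0) &
      forall A C, F A -> F C -> exists2 D, F D & D `<=` A `&` C].

Definition b_filter {X : Type} (B F : set (set X)) : Prop :=
  [/\ filterbase F, F `<=` B &
      forall A G, F A -> A `<=` G -> B G -> F G].

Definition b_ultrafilter {X : Type} (B F : set (set X)) : Prop :=
  b_filter B F /\ forall G, b_filter B G -> F `<=` G -> G = F.

Definition type_b {X : Type} (B : set (set X)) (mu : set (set X)) : Prop :=
  UltraFilter mu /\ b_ultrafilter B (mu `&` B).

Definition Pi_b {X : Type} (B : set (set X)) (alpha : set (set X)) :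
    set (set X) :=
  \bigcup_(u in [set u : set (set X) |
      UltraFilter u /\ near_families (wallman_frink B) u alpha]) u.

Definition grill {X : Type} (gamma : set (set X)) : Prop :=
  [/\ gamma !=set0, (forall A, gamma A -> A !=set0),
      (forall A C, gamma A -> A `<=` C -> gamma C) &
      forall A C, gamma (A `|` C) -> gamma A \/ gamma C].

Definition clan {X : Type} (delta : set X -> set X -> Prop)
    (gamma : set (set X)) : Prop :=
  grill gamma /\ forall A C, gamma A -> gamma C -> delta A C.

Definition maximal_clan {X : Type} (delta : set X -> set X -> Prop)
    (gamma : set (set X)) : Prop :=
  clan delta gamma /\
  forall gamma', clan delta gamma' -> gamma `<=` gamma' -> gamma' = gamma.

Record completion {X : Type} (delta : set X -> set X -> Prop) : Type :=
  Completion {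
    clan_of : set (set X);
    clan_ofP : maximal_clan delta clan_of }.

HB.instance Definition _ (X : Type) (delta : set X -> set X -> Prop) :=
  gen_eqMixin (completion delta).
HB.instance Definition _ (X : Type) (delta : set X -> set X -> Prop) :=
  gen_choiceMixin (completion delta).

Definition absorb {X : Type} (delta : set X -> set X -> Prop) (A : set X) :
    set (completion delta) :=
  [set s | clan_of s A].

Section absorption_topology.
Context {X : Type} {delta : set X -> set X -> Prop}.

Lemma absorb0 : @absorb X delta set0 = set0.
Proof.
rewrite -subset0 => s s0.
by have [[[_ ne _ _] _] _] := clan_ofP s; have [] := ne _ s0.
Qed.

Lemma absorbT : @absorb X delta setT = setT.
Proof.
rewrite -subTset => s _.
by have [[[[A sA] _ up _] _] _] := clan_ofP s; exact: up sA _.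
Qed.

Lemma absorbU (A C : set X) :
  @absorb X delta (A `|` C) = absorb A `|` absorb C.
Proof.
apply/seteqP; split=> s; have [[[_ _ up gr] _] _] := clan_ofP s.
  exact: gr.
by case=> sA; apply: (up _ _ sA) => x ?; [left|right].
Qed.

Lemma absorbC_cover :
  \bigcup_(A in [set: set X]) ~` @absorb X delta A = setT.
Proof. by rewrite -subTset => s _; exists set0; rewrite // absorb0. Qed.

Lemma absorbC_join (A C : set X) (s : completion delta) :
  [set: set X] A -> [set: set X] C -> (~` absorb A) s -> (~` absorb C) s ->
  exists D, [/\ [set: set X] D, (~` absorb D) s &
                ~` @absorb X delta D `<=` ~` absorb A `&` ~` absorb C].
Proof.
by move=> _ _ sA sC; exists (A `|` C); split; rewrite // absorbU setCU.
Qed.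

(* Absorption topology: the complements of the sets [absorb A] form a base of
   open sets, i.e. the sets [absorb A] form a base of closed sets (see
   [closed_base_absorb]). *)
HB.instance Definition _ := isBaseTopological.Build (completion delta)
  absorbC_cover absorbC_join.

Lemma closed_base_absorb : closed_base (range (@absorb X delta)).
Proof.
have oA (A : set X) : open (~` @absorb X delta A).
  by exists [set A]; rewrite ?bigcup_set1.
split=> [_ [A _ <-]|C cC]; first by rewrite -openC.
have [D _ DE] : open (~` C) by rewrite openC.
exists (@absorb X delta @` (D `|` [set setT])); split.
- by move=> _ [A _ <-]; exists A.
- by exists (absorb setT), setT => //; right.
- rewrite -[LHS]setCK -DE setC_bigcup bigcap_image bigcap_setU bigcap_set1.
  by rewrite absorbT setIT; apply: eq_bigcapr => A _; rewrite setCK.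
Qed.

End absorption_topology.

Definition Tb {X : Type} (B : set (set X)) : set (set (set X)) :=
  [set Pi_b B alpha | alpha in type_b B].

(* [Tb B] viewed inside the completion; as a type it carries the subspace
   topology (the initial topology of the inclusion). *)
Definition TbX {X : Type} (B : set (set X)) :
    set (completion (wallman_frink B)) :=
  @clan_of X (wallman_frink B) @^-1` Tb B.
Arguments TbX {X} B _.

Definition homeomorphism {S T : topologicalType} (f : S -> T) : Prop :=
  continuous f /\
  exists g : T -> S, [/\ cancel f g, cancel g f & continuous g].

(* Main.v *)
(* For alpha of type b, A belongs to Pi alpha iff every member of B containing A
   belongs to alpha.  Hence Pi alpha is determined by the b-ultrafilter of its
   members lying in B, it is a maximal clan, and the closed sets of TbX are
   generated by the traces of the sets F^* with F in B: TbX is a copy of the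
   Wallman space of b-ultrafilters.  Compactness comes from extending a b-filter
   to a b-ultrafilter; Pi mu_x consists of the sets whose closure contains x, so
   x |-> Pi mu_x pulls the trace of A^* back to the closure of A. *)
Require Import Defs.
From HB Require Import structures.
From mathcomp Require Import all_boot all_classical topology.

Local Open Scope classical_set_scope.

(** Choice gives [g] with [f (g y)] equal to the value of [y]. So [g] pulls the preimage of [C']
    under [f] back to the trace of [C'] on the range: the third hypothesis is exactly continuity of
    the inverse. *)
Lemma embedding_range {S T : topologicalType} (f : S -> T) :
    injective f -> continuous f ->
    (forall C, closed C -> exists2 C' : set T, closed C' & f @^-1` C' = C) ->
  exists h : S -> range f,
    homeomorphism h /\ forall x, set_val (h x) = f x.
Proof.
move=> finj fcont fclosed.
pose h x : range f := exist _ (f x) (mem_set (imageT f x)).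
have hE x : set_val (h x) = f x by [].
have /choice[g gE] (y : range f) : exists x, f x = set_val y.
  by have [x _ xE] := set_valP y; exists x.
exists h; split=> //; split.
  exact: (@continuous_comp_initial _ _ _ set_val).
exists g; split.
- by move=> x; apply: finj; rewrite gE.
- by move=> y; apply: val_inj; rewrite -set_valE hE gE.
- apply/continuous_closedP => C /fclosed[C' C'cl <-].
  rewrite -openC; exists (~` C'); first by rewrite openC.
  by rewrite -preimage_setC; congr (~` _);
    apply/seteqP; split=> y /=; rewrite gE.
Qed.

(** * Filters in [B] and their maximal extensions *)

Lemma directed_bigcup_b_filter {X I : Type} (B : set (set X)) (D : set I)
    (F : I -> set (set X)) :
    D !=set0 -> (forall i, D i -> b_filter B (F i)) ->
    (forall i j, D i -> D j ->
       exists2 k, D k & F i `<=` F k /\ F j `<=` F k) ->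
  b_filter B (\bigcup_(i in D) F i).
Proof.
move=> [i0 Di0] bF dir; split; first split.
- by have [[[A FA] _ _] _ _] := bF _ Di0; exists A, i0.
- by move=> A [i Di FA]; have [[_ ne _] _ _] := bF _ Di; exact: ne.
- move=> A C [i Di FA] [j Dj FC]; have [k Dk [ik jk]] := dir _ _ Di Dj.
  have [[_ _ cap] _ _] := bF _ Dk.
  by have [E FE sE] := cap _ _ (ik _ FA) (jk _ FC); exists E => //; exists k.
- by move=> A [i Di FA]; have [_ sub _] := bF _ Di; exact: sub.
- move=> A G [i Di FA] AG BG; have [_ _ up] := bF _ Di.
  by exists i => //; exact: up FA AG BG.
Qed.

Lemma b_filter_ultra {X : Type} (B N : set (set X)) :
  b_filter B N -> exists2 M, b_ultrafilter B M & N `<=` M.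
Proof.
(* [Zorn_bigcup] includes the empty chain, whose union is empty; adjoining [N] makes [P set0] true
   and keeps every candidate above [N]. *)
move=> bN; pose P S := b_filter B (N `|` S).
have [|M [bM Mmax]] := @Zorn_bigcup (set X) P.
  move=> C CP Ctot.
  (* Adding [set0] to the chain keeps the index set of the directed union nonempty. *)
  rewrite /P; suff -> : N `|` \bigcup_(S in C) S =
      \bigcup_(S in C `|` [set set0]) (N `|` S).
    apply: directed_bigcup_b_filter; first by exists set0; right.
      by move=> S [/CP //|->]; rewrite setU0.
    move=> S S' [CS|->] [CS'|->].
    - have [sub|sub] := Ctot _ _ CS CS'; [exists S'|exists S]; rewrite ?subsetUr//;
        by [left|split=> //; exact: setUS].
    - by exists S; [left|split=> //; exact: setUS].
    - by exists S'; [left|split=> //; exact: setUS].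
    - by exists set0; [right|split].
  apply/seteqP; split=> A.
    by move=> [NA|[S CS SA]]; [exists set0; [right|left]|exists S; [left|right]].
  by move=> [S [CS|->] [NA|SA]]; [left|right; exists S|left|].
exists (N `|` M); last exact: subsetUl.
split=> // G bG NMG; apply: contrapT => GNM; apply: (Mmax G).
  split; last by move=> GM; apply: GNM; apply/seteqP; split=> // A /GM; right.
  by move=> A MA; apply: NMG; right.
by rewrite /P (_ : N `|` G = G)//; apply/setUidPr => A NA; apply: NMG; left.
Qed.

(** The members of [B] that contain the trace on [F] of some member of [M] form a b-filter
    containing both [M] and [F]; by maximality it is [M]. *)
Lemma b_ultrafilter_meet {X : Type} (B M : set (set X)) (F : set X) :
    setI_closed B -> b_ultrafilter B M -> B F ->
    (forall G, M G -> F `&` G !=set0) ->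
  M F.
Proof.
move=> BI [[[[A0 MA0] Mne Mcap] MB Mup] Mmax] BF meet.
pose G := [set H | B H /\ exists2 A, M A & F `&` A `<=` H].
have GF : G F by split=> //; exists A0 => // x [].
rewrite -(Mmax G) //; last first.
  by move=> A MA; split; [exact: MB|exists A => // x []].
split; first split.
- by exists F.
- by move=> H [_ [A /meet[x FAx] sub]]; exists x; exact: sub.
- move=> H K [BH [A MA sH]] [BK [A' MA' sK]].
  exists (H `&` K) => //; split; first exact: BI.
  have [E ME sE] := Mcap _ _ MA MA'; exists E => // x [Fx /sE[Ax A'x]].
  by split; [apply: sH|apply: sK].
- by move=> H [].
- by move=> H K [_ [A MA sH]] HK BK; split=> //; exists A => // x /sH/HK.
Qed.

Lemma ultra_b_filter {X : Type} (B u : set (set X)) :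
  B setT -> setI_closed B -> UltraFilter u -> b_filter B (u `&` B).
Proof.
move=> BT BI uU; split; first split.
- by exists setT; split=> //; exact: filterT.
- by move=> A [uA _]; exact: filter_ex uA.
- move=> A C [uA BA] [uC BC]; exists (A `&` C) => //.
  by split; [exact: filterI|exact: BI].
- by move=> A [].
- by move=> A G [uA _] AG BG; split=> //; exact: filterS uA.
Qed.

(** Any ultrafilter [u] finer than the filter generated by [M] works: its trace on [B] is a b-filter
    containing [M], hence equal to [M]. *)
Lemma b_ultrafilter_type_b {X : Type} (B M : set (set X)) :
    B setT -> setI_closed B -> b_ultrafilter B M ->
  exists2 alpha, type_b B alpha & alpha `&` B = M.
Proof.
move=> BT BI bM; have [[[[A0 MA0] Mne Mcap] MB Mup] Mmax] := bM.
have PF : ProperFilter (filter_from M id).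
  apply: filter_from_proper; last exact: Mne.
  by apply: filter_from_filter; [exists A0|exact: Mcap].
have [u [uU Mu]] := ultraFilterLemma PF.
have uBE : u `&` B = M.
  apply: Mmax; first exact: ultra_b_filter.
  by move=> A MA; split; [apply: Mu; exists A|exact: MB].
by exists u => //; split=> //; rewrite uBE.
Qed.

(** * The families [Pi_b B alpha] as maximal clans *)

Lemma ultra_setU {X : Type} {u : set (set X)} (uU : UltraFilter u)
    (A C : set X) :
  u (A `|` C) -> u A \/ u C.
Proof.
move=> uAC; have [|uA] := in_ultra_setVsetC A uU; first by left.
by right; apply: filterS (filterI uAC uA) => x [[]].
Qed.

Lemma proper_filter_meet {X : Type} {u : set (set X)} (uP : ProperFilter u)
    (F G : set X) :
  u F -> u G -> F `&` G <> set0.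
Proof.
move=> uF uG FG; have : u (F `&` G) by exact: filterI.
by rewrite FG => /filter_ex[].
Qed.

(** If [A] lies in some [u] near [alpha] and [F] in [B] contains [A], then [F] meets every [G] of
    [alpha] in [B], since otherwise [F] and [G] would separate [A] from [G]; maximality of the trace
    of [alpha] then gives [alpha F]. The converse constructs [u]. *)
Lemma Pi_bE {X : Type} (B alpha : set (set X)) (A : set X) :
    B set0 -> setU_closed B -> setI_closed B -> type_b B alpha ->
  Pi_b B alpha A <-> forall F, B F -> A `<=` F -> alpha F.
Proof.
move=> B0 BU BI [aU aB]; split.
  move=> [u [uU nua] uA] F BF AF.
  suff [] : (alpha `&` B) F by [].
  apply: (b_ultrafilter_meet B (alpha `&` B)) => // G [aG BG].
  apply/set0P/eqP => FG0; apply: (nua A G) => //.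
  by exists F, G; split=> // x.
(* An ultrafilter containing all A `\` F, F in B outside alpha, is near alpha;
   B set0 ensures that it contains A itself. *)
move=> Aa; pose D F := B F /\ ~ alpha F.
have D0 : D set0 by split=> // /filter_ex[].
have PF : ProperFilter (filter_from D (fun F => A `\` F)).
  apply: filter_from_proper.
    apply: filter_from_filter; first by exists set0.
    move=> F G [BF aF] [BG aG]; exists (F `|` G); last by rewrite setDUr.
    by split; [exact: BU|move=> /(ultra_setU aU)[]].
  move=> F [BF aF]; apply/set0P/eqP => AF0; apply: aF; apply: Aa => //.
  by rewrite -setD_eq0.
have [u [uU Du]] := ultraFilterLemma PF.
exists u; last by apply: Du; exists set0 => // x [].
split=> // C E uC aE [F1 [F2 [BF1 BF2 CF1 EF2 F12]]].
(* [F2] contains [E], so it is in [alpha] and the disjoint [F1] is not; thus [u] contains the part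
   of [A] outside [F1], which is disjoint from [C]. *)
have aF1 : ~ alpha F1.
  by move=> aF1; exact: (proper_filter_meet _ _ _ aF1 (filterS EF2 aE)).
have uAF1 : u (A `\` F1) by apply: Du; exists F1.
by have [x [/CF1 F1x []]] := filter_ex (filterI uC uAF1).
Qed.

Lemma ultra_near_refl {X : Type} (B u : set (set X)) :
  UltraFilter u -> near_families (wallman_frink B) u u.
Proof.
move=> uU A C uA uC [F1 [F2 [_ _ AF CF F12]]].
exact: (proper_filter_meet _ _ _ (filterS AF uA) (filterS CF uC)).
Qed.

Lemma ultra_sub_Pi_b {X : Type} (B u : set (set X)) :
  UltraFilter u -> u `<=` Pi_b B u.
Proof. by move=> uU A uA; exists u => //; split=> //; exact: ultra_near_refl. Qed.

(** Two separating members of [B] would both lie in [alpha], so the grill is a clan. A larger clan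
    [g] still contains [alpha], so any [F] in [B] above a member of [g] meets all of [alpha] in [B],
    and [b_ultrafilter_meet] applies again. *)
Lemma Pi_b_maximal_clan {X : Type} (B alpha : set (set X)) :
    B set0 -> setU_closed B -> setI_closed B -> type_b B alpha ->
  maximal_clan (wallman_frink B) (Pi_b B alpha).
Proof.
move=> B0 BU BI aT; have PE A := Pi_bE B alpha A B0 BU BI aT.
have [aU _] := aT; have aPi := ultra_sub_Pi_b B alpha aU.
split; first split; first split.
- by exists setT; apply: aPi; exact: filterT.
- by move=> A [u [uU _] /filter_ex].
- by move=> A C [u uP uA] AC; have [uU _] := uP;
  exists u => //; exact: filterS uA.
- move=> A C [u uP uAC]; have [uU _] := uP.
  by have [uA|uC] := ultra_setU uU A C uAC; [left|right]; exists u.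
- move=> A C /PE PA /PE PC [F1 [F2 [BF1 BF2 AF CF F12]]].
  exact: (proper_filter_meet _ _ _ (PA _ BF1 AF) (PC _ BF2 CF)).
move=> g [_ gnear] Pig; apply/seteqP; split=> // A gA; apply/PE => F BF AF.
have [_ aB] := aT; suff [] : (alpha `&` B) F by [].
apply: (b_ultrafilter_meet B (alpha `&` B)) => // G [aG BG].
apply/set0P/eqP => FG0; apply: (gnear A G) => //; first exact/Pig/aPi.
by exists F, G; split=> // x.
Qed.

(** * Separation in the completion and its subspaces *)

Lemma maximal_clan_subset {X : Type} (delta : set X -> set X -> Prop)
    (s t : completion delta) :
  clan_of s `<=` clan_of t -> s = t.
Proof.
move=> st; have [_ /(_ _ _ st) ts] := clan_ofP s.
have {ts} := ts (proj1 (clan_ofP t)).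
case: s t {st} => [s sP] [t tP] /= ts; rewrite ts in tP *.
by congr Completion; exact: Prop_irrelevance.
Qed.

Lemma accessible_completion {X : Type} (delta : set X -> set X -> Prop) :
  accessible_space (completion delta).
Proof.
move=> s t /eqP st.
have /existsNP[A /not_implyP[tA sA]] : ~ clan_of t `<=` clan_of s.
  by move=> /maximal_clan_subset ts; exact: st.
exists (~` absorb A); split; [|exact/mem_set|by rewrite setCK; exact/mem_set].
by rewrite openC; apply: (closed_base_absorb (delta := delta)).1; exists A.
Qed.

Lemma accessible_set_type {T : topologicalType} (A : set T) :
  accessible_space T -> accessible_space A.
Proof.
move=> T1 x y xy; have [|O [oO Ox Oy]] := T1 (set_val x) (set_val y).
  by apply: contra xy => /eqP/val_inj ->.
exists (set_val @^-1` O); split; first by exists O.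
- by apply/mem_set; exact: set_mem Ox.
- by apply/mem_set; exact: set_mem Oy.
Qed.

(** * Normal bases and the clans of points *)

Lemma normal_baseT {X : topologicalType} (B : set (set X)) :
  normal_base B -> B setT.
Proof.
move=> [[_ /(_ _ closedT)[S [SB [F SF] TE]]] _ _ _].
suff <- : F = setT by exact: SB.
by rewrite -subTset TE; exact: bigcap_inf.
Qed.

Lemma normal_base_separation {X : topologicalType} (B : set (set X))
    (x : X) (F : set X) :
  normal_base B -> B F -> ~ F x -> exists G, [/\ B G, G x & F `&` G = set0].
Proof.
move=> [[Bcl _] net _ _] BF Fx.
have [|G [BG Gx GF]] := net x (~` F) _ Fx; first by rewrite openC; exact: Bcl.
by exists G; split=> //; apply/seteqP; split=> // y [Fy /GF].
Qed.

(** Two distinct points lie in disjoint members of [B], and [B] is closed under intersections. *)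
Lemma normal_base0 {X : topologicalType} (B : set (set X)) :
    accessible_space X -> (exists x y : X, x <> y) -> normal_base B ->
  B set0.
Proof.
move=> T1 [x [y xy]] nB; have [_ net _ BI] := nB.
have [|O [oO /set_mem Ox /set_mem Oy]] := T1 x y; first exact/eqP.
have [F [BF Fx FO]] := net x O oO Ox.
have [|G [BG Gy <-]] := normal_base_separation B y F nB BF; first by move=> /FO.
exact: BI.
Qed.

Lemma principal_type_b {X : topologicalType} (B : set (set X)) (x : X) :
  normal_base B -> type_b B [set A : set X | A x].
Proof.
move=> nB; have [_ _ _ BI] := nB.
have uU : UltraFilter [set A : set X | A x].
  rewrite (_ : [set A | A x] = principal_filter x).
    exact: principal_filter_ultra.
  by apply/predeqP => A; rewrite principal_filterP.
split=> //; split; first by apply: ultra_b_filter => //; exact: normal_baseT.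
move=> G [[_ Gne Gcap] GB _] sub; apply/seteqP; split=> // F GF.
split; last exact: GB.
(* If [F] missed [x], the network property would give [H] in [B] through [x] disjoint from [F]; but
   [H] already belongs to the larger filter [G]. *)
apply: contrapT => /(normal_base_separation B x F nB (GB _ GF))[H [BH Hx FH]].
have [E /Gne[y Ey] sE] := Gcap _ _ GF (sub H (conj Hx BH)).
by have := sE _ Ey; rewrite FH.
Qed.

(** The closure of [A] is an intersection of members of [B], all containing [A], so the criterion
    [Pi_bE] tests membership of [x] in that closure. *)
Lemma Pi_b_principalE {X : topologicalType} (B : set (set X)) (x : X) :
    B set0 -> normal_base B ->
  Pi_b B [set A : set X | A x] = [set A | closure A x].
Proof.
move=> B0 nB; have [[Bcl Bbase] _ BU BI] := nB.
have PE A := Pi_bE B _ A B0 BU BI (principal_type_b B x nB).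
apply/seteqP; split=> A.
  move=> /PE PA; have [S [SB _ clAE]] := Bbase _ (@closed_closure _ A).
  rewrite /= clAE => F SF; apply: PA; first exact: SB.
  by apply: subset_trans (@subset_closure _ A) _; rewrite clAE; exact: bigcap_inf.
move=> clA; apply/PE => F BF AF.
by have /closure_id -> := Bcl _ BF; exact: closureS clA.
Qed.

(** * Neighbourhoods in [TbX B] and compactness *)

Lemma Pi_b_baseE {X : Type} (B alpha : set (set X)) (F : set X) :
    B set0 -> setU_closed B -> setI_closed B -> type_b B alpha -> B F ->
  Pi_b B alpha F <-> alpha F.
Proof.
move=> B0 BU BI aT BF; rewrite Pi_bE//; split; first exact.
by have [aU _] := aT; move=> aF G _ FG; exact: filterS aF.
Qed.

Lemma completion_nbhs_absorb {X : Type} (delta : set X -> set X -> Prop)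
    (s : completion delta) (V : set (completion delta)) :
  open V -> V s -> exists A, ~ clan_of s A /\ ~` absorb A `<=` V.
Proof.
move=> oV Vs; have [S [SB _ VE]] : exists S : set (set (completion delta)),
    [/\ S `<=` range (@absorb _ delta), S !=set0 & ~` V = \bigcap_(F in S) F].
  by apply: closed_base_absorb.2; rewrite closedC.
have /existsNP[F /not_implyP[SF Fs]] : ~ (\bigcap_(F in S) F) s by rewrite -VE.
have [A _ AF] := SB _ SF; exists A; split.
  by move=> sA; apply: Fs; rewrite -AF.
move=> t tA; apply: contrapT => Vt; apply: tA; rewrite AF.
by have : (~` V) t by []; rewrite VE; exact.
Qed.

Lemma TbXP {X : Type} (B : set (set X)) (p : TbX B) :
  exists2 alpha, type_b B alpha & clan_of (set_val p) = Pi_b B alpha.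
Proof. by have [alpha aT <-] := set_valP p; exists alpha. Qed.

Lemma TbX_ofP {X : Type} (B alpha : set (set X)) :
    B set0 -> setU_closed B -> setI_closed B -> type_b B alpha ->
  exists p : TbX B, clan_of (set_val p) = Pi_b B alpha.
Proof.
move=> B0 BU BI aT.
pose s := Completion (Pi_b_maximal_clan B alpha B0 BU BI aT).
have sT : TbX B s by exists alpha.
by exists (exist _ s (mem_set sT)).
Qed.

(** If [Pi_b B alpha] omits [A], then [alpha] omits some [F] in [B] containing [A]. Passing from [A]
    to [F] shrinks the basic neighbourhood, since clans are closed under supersets. *)
Lemma TbX_nbhs {X : Type} (B : set (set X)) (p : TbX B) (O : set (TbX B)) :
    B set0 -> setU_closed B -> setI_closed B -> nbhs p O ->
  exists F, [/\ B F, ~ clan_of (set_val p) F &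
    [set q : TbX B | ~ clan_of (set_val q) F] `<=` O].
Proof.
move=> B0 BU BI; rewrite nbhsE => -[O' [[V oV <-] Vp] VO].
have [A [pA AV]] := completion_nbhs_absorb _ _ V oV Vp.
have [alpha aT pE] := TbXP B p.
move: pA; rewrite {1}pE Pi_bE// =>
  /existsNP[F /not_implyP[BF /not_implyP[AF aF]]].
exists F; split=> //; first by rewrite pE Pi_b_baseE.
move=> q /= qF; apply/VO/AV => qA; apply: qF.
have [[[_ _ up _] _] _] := clan_ofP (set_val q); exact: up qA AF.
Qed.

Lemma TbX_compact {X : Type} (B : set (set X)) :
    B set0 -> B setT -> setU_closed B -> setI_closed B ->
  compact [set: TbX B].
Proof.
move=> B0 BT BU BI; rewrite compact_ultra => U UU _.
pose tr F := [set p : TbX B | clan_of (set_val p) F].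
pose N := [set F | B F /\ U (tr F)].
have bN : b_filter B N.
  split; first split.
  - exists setT; split=> //; rewrite (_ : tr setT = setT); first exact: filterT.
    rewrite -subTset => p _.
    by have [[[[A pA] _ up _] _] _] := clan_ofP (set_val p); exact: up pA _.
  - move=> F [_ /filter_ex[p pF]].
    by have [[[_ ne _ _] _] _] := clan_ofP (set_val p); exact: ne.
  - move=> F G [BF UF] [BG UG]; exists (F `&` G) => //; split; first exact: BI.
    (* Clans need not be closed under intersections, but on [B] each point of [TbX B] agrees with an
       ultrafilter. *)
    apply: filterS (filterI UF UG) => p []; rewrite /tr /=.
    have [alpha aT ->] := TbXP B p; have [aU _] := aT.
    rewrite !Pi_b_baseE //; [exact: filterI|exact: BI].
  - by move=> F [].
  - move=> F G [_ UF] FG BG; split=> //; apply: filterS UF => p pF.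
    by have [[[_ _ up _] _] _] := clan_ofP (set_val p); exact: up pF FG.
have [M bM NM] := b_filter_ultra B N bN.
have [alpha aT aM] := b_ultrafilter_type_b B M BT BI bM.
have [p pE] := TbX_ofP B alpha B0 BU BI aT.
exists p; split=> // O /(TbX_nbhs B p O B0 BU BI)[F [BF pF FO]].
(* If [tr F] were in [U], then [F] would be in [N], hence in [M] and in the clan of [p]; so [U]
   contains the complement of [tr F]. *)
have [UF|] := in_ultra_setVsetC (tr F) UU; last by apply: filterS.
case: pF; rewrite pE Pi_b_baseE//.
suff [] : (alpha `&` B) F by [].
by rewrite aM; apply: NM.
Qed.

Theorem theorem14 (X : topologicalType) (B : set (set X))
    (X_T1 : accessible_space X)
    (X_two_points : exists x y : X, x <> y)
    (B_normal : normal_base B) :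
  Tb B `<=` maximal_clan (wallman_frink B) /\
  [/\ compact [set: TbX B],
      accessible_space (TbX B) &
      exists D : set (TbX B), dense D /\
        exists h : X -> D, homeomorphism h /\
          forall x : X,
            clan_of (set_val (set_val (h x))) = Pi_b B [set A : set X | A x]].
Proof.
have B0 := normal_base0 B X_T1 X_two_points B_normal.
have BT := normal_baseT B B_normal.
have [[Bcl _] _ BU BI] := B_normal.
split; first by move=> _ [alpha aT <-]; exact: Pi_b_maximal_clan.
split; [exact: TbX_compact|exact/accessible_set_type/accessible_completion|].
have muT x := principal_type_b B x B_normal.
have muE x := Pi_b_principalE B x B0 B_normal.
have /choice[k kE] x := TbX_ofP B _ B0 BU BI (muT x).
(* Points are closed, so the clan of [x] contains the singleton of [x] but of no other point. *)
have kinj : injective k.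
  move=> x y kxy; apply: contrapT => /eqP xy.
  have x1 : closed [set x] by exact: accessible_closed_set1.
  have : closure [set x] y.
    rewrite -[closure _ y]/([set A | closure A y] [set x]) -muE -kE -kxy kE muE /=.
    exact: subset_closure.
  by rewrite -(closure_id _).1// => /= yx; move: xy; rewrite yx eqxx.
have kpre A : k @^-1` (set_val @^-1` absorb A) = closure A.
  by apply/seteqP; split=> x; rewrite /absorb /= kE muE.
have kcont : continuous k.
  apply: (@continuous_comp_initial _ _ _ set_val); apply/continuous_closedP => C.
  move=> /closed_base_absorb.2[S [SA _ ->]].
  rewrite preimage_bigcap; apply: closed_bigI => F /SA[A _ <-].
  rewrite comp_preimage kpre; exact: closed_closure.
have kclosed C : closed C ->
    exists2 C' : set (TbX B), closed C' & k @^-1` C' = C.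
  move=> Ccl; exists (set_val @^-1` absorb C); last by rewrite kpre -(closure_id C).1.
  rewrite -openC; exists (~` absorb C) => //.
  by rewrite openC; apply: closed_base_absorb.1; exists C.
have [h [hh hE]] := embedding_range k kinj kcont kclosed.
exists (range k); split; last by exists h; split=> // x; rewrite hE kE.
move=> O [p Op] oO.
have [F [BF pF FO]] := TbX_nbhs B p O B0 BU BI (open_nbhs_nbhs (conj oO Op)).
(* Every clan contains the whole space, so [F] is proper. As [F] is closed, the clan of any [x]
   outside [F] omits [F], which puts [k x] in [O]. *)
have /existsNP[x Fx] : ~ (forall x, F x).
  move=> FT; apply: pF; have [[[[A pA] _ up _] _] _] := clan_ofP (set_val p).
  by apply: up pA _ => x _; exact: FT.
exists (k x); split; last by exists x.
apply: FO; rewrite /= kE muE => clF; apply: Fx.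
by rewrite (closure_id F).1; [|exact: Bcl].
Qed.
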